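(* Let $r$ be a positive integer, let $P$ be an $r$-differential poset, and let $\mathbb{N}=\{0,1,2,\dots\}$. Let $n\in\mathbb{N}$ and $x\in P_n$. Then for all $k\in\mathbb{N}$, $$e(x)\,r^k(n+1)^k=\sum_{y\in P_n} t_k(x\rightarrow y)\,e(y),$$ and for all $k\in\mathbb{N}$ with $k\ge 1$, $$e(x)\,r^k(n+1)^k=\sum_{y\in P_{n+1}} t_{k-\frac12}(x\rightarrow y)\,e(y).$$
   Context: Let $r\ge 1$ be an integer. A poset $P$ is called $r$-differential if: (D1) $P$ is locally finite, graded, and has a minimum element $\hat 0$; (D2) if $x\neq y$ in $P$ and there are exactly $k$ elements of $P$ covered by both $x$ and $y$, then there are exactly $k$ elements of $P$ which cover both $x$ and $y$; (D3) if $x\in P$ covers exactly $k$ elements of $P$, then $x$ is covered by exactly $k+r$ elements of $P$. Let $\rho$ be the rank function of $P$ (with $\rho(\hat 0)=0$, and $\rho(y)=\rho(x)+1$ whenever $y$ covers $x$), and let $P_n=\{x\in P:\rho(x)=n\}$. For $x\in P$, $e(x)$ denotes the number of saturated chains from $\hat 0$ to $x$ (so $e(\hat 0)=1$). An up-down alternating walk starting at $x\in P_n$ is a sequence $x=y_0\le y_{1/2}\ge y_1\le y_{3/2}\ge y_2\le\cdots$ of elements of $P$ in which any two consecutive elements are adjacent in the Hasse diagram of $P$ (so $y_i\in P_n$ and $y_{i+1/2}\in P_{n+1}$ for integers $i$). Its length is the number of steps. For $x,y\in P_n$, $t_k(x\rightarrow y)$ is the number of up-down alternating walks of length $2k$ from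 $x$ to $y$ (ending at $y_k=y$). For $x\in P_n$, $y\in P_{n+1}$ and $k\ge1$, $t_{k-\frac12}(x\rightarrow y)$ is the number of up-down alternating walks of length $2k-1$ from $x$ to $y$ (ending at $y_{k-1/2}=y$). *)

(* Defs.v *)
From mathcomp Require Import all_boot all_order finmap.
From mathcomp Require Import boolp classical_sets functions cardinality fsbigop.

Set Implicit Arguments.
Unset Strict Implicit.
Unset Printing Implicit Defensive.

Local Open Scope classical_set_scope.
Local Open Scope fset_scope.
Local Open Scope card_scope.
Local Open Scope nat_scope.

Section Poset.
Context {d : Order.disp_t} {P : bPOrderType d}.
Implicit Types (x y z : P) (n m k r : nat) (rho : P -> nat).

(* [covered_by x y]: y covers x. Boolean, so that it can be used with [path]. *)
Definition covered_by : rel P := fun x y =>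
  `[< (x < y)%O /\ forall z, ~ ((x < z)%O /\ (z < y)%O) >].

Definition locally_finite : Prop :=
  forall x y, finite_set [set z : P | (x <= z)%O && (z <= y)%O].

Definition rank_function rho : Prop :=
  rho \bot%O = 0 /\ forall x y, covered_by x y -> rho y = (rho x).+1.

Definition graded : Prop := exists rho, rank_function rho.

Definition rank_level rho n : set P := [set x | rho x = n].

(* [e x] counts the saturated chains \bot = x_0 < x_1 < ... < x_l = x, each
   given by the list [:: x_1; ...; x_l]. [fset_set] is meaningful only on
   finite sets, which these are as soon as P is locally finite. *)
Definition saturated_chains x : set (seq P) :=
  [set s | path covered_by \bot%O s && (last \bot%O s == x)].

Definition e x : nat := #|` fset_set (saturated_chains x)|.

(* The list s gives the points of an alternating walk after its starting
   point x; its first step goes up if [up], down otherwise. *)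
Fixpoint alt_walk (up : bool) x (s : seq P) : bool :=
  if s is y :: s' then
    (if up then covered_by x y else covered_by y x) && alt_walk (~~ up) y s'
  else true.

Definition up_down_walks m x y : set (seq P) :=
  [set s | [&& size s == m, alt_walk true x s & last x s == y]].

(* The first argument is the length m of the walks, so that t_j(x -> y) is
   [t j.*2 x y] and t_(j - 1/2)(x -> y) is [t (j.*2).-1 x y]. The set is finite
   when every element is covered by, and covers, finitely many elements. *)
Definition t m x y : nat := #|` fset_set (up_down_walks m x y)|.

End Poset.

Arguments locally_finite {d} P.
Arguments graded {d} P.

(* The minimum element is part of [bPOrderType]. *)
Record differential (r : nat) (d : Order.disp_t) (P : bPOrderType d) : Prop := {
  differential_locally_finite : locally_finite P;
  differential_graded : graded P;
  differential_common_covers : forall (x y : P) (k : nat), x <> y ->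
    [set z | covered_by z x /\ covered_by z y] #= `I_k ->
    [set z | covered_by x z /\ covered_by y z] #= `I_k;
  differential_covers : forall (x : P) (k : nat),
    [set z | covered_by z x] #= `I_k ->
    [set z | covered_by x z] #= `I_(k + r)
}.

Arguments differential r {d} P.

(* Main.v *)
Require Import Defs.
From mathcomp Require Import all_boot all_order finmap.
From mathcomp Require Import boolp classical_sets functions cardinality fsbigop.

Local Open Scope classical_set_scope.
Local Open Scope nat_scope.

(** With U f x the sum of f over the upper covers of x, and D f x the sum of f
    over its lower covers, axioms (D2) and (D3) say that D and U almost commute:
    U (D f) = D (U f) + r f (lemma [down_up_commutation]). Indeed both sides are
    sums of f z weighted by the number of two-step paths from x to z, up then
    down on the left, down then up on the right. For z <> x the two numbers agree
    by (D2), and for z = x they differ by r by (D3).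

    Cutting a saturated chain before its last element gives D e x = e x whenever
    x has positive rank ([sum_lower_chains]). Every upper cover has positive rank,
    so the commutation relation becomes U e x = D (U e) x + r e x, and an
    induction on the rank n of x yields U e x = r (n + 1) e x
    ([sum_upper_chains]): e behaves like an eigenvector.

    The two identities of the theorem are one statement: the sum of
    t_(m/2)(x -> y) e(y) over y is the sum of e over the endpoints of all
    alternating walks of length m from x. Peeling off the first step of the walk
    applies U or D in turn between the ranks n and n + 1. Each up step
    contributes a factor r (n + 1), each down step a factor 1, and a walk of
    length m that starts upwards has ceil(m / 2) up steps. *)

(** * Counting finite sets by enumeration *)

Lemma card_fset_set_enum (T : choiceType) (A : set T) (l : seq T) :
  uniq l -> (forall a, A a <-> a \in l) -> #|` fset_set A| = size l.
Proof.
move=> uniq_l Al.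
suff -> : A = [set` [fset a in l]%fset].
  by rewrite set_fsetK card_fseq undup_id.
by apply/seteqP; split=> a /=; rewrite inE; move/Al.
Qed.

(** The common form of the double sums below: the weight of a is the number of
    ways of reaching it. The auxiliary list u serves to put two such double sums
    over the same range, where their weights can be compared. *)
Lemma exchange_incidences (I T : choiceType) (s : seq I) (g : I -> seq T) (u : seq T)
    (f : T -> nat) :
  uniq u -> (forall i, uniq (g i)) -> {in s, forall i, {subset g i <= u}} ->
  \sum_(i <- s) \sum_(a <- g i) f a
    = \sum_(a <- u) count (fun i => a \in g i) s * f a.
Proof.
move=> uniq_u uniq_g sub_u.
under eq_big_seq => i si.
  rewrite (perm_big [seq a <- u | a \in g i]) /=; last first.
    apply: uniq_perm; rewrite ?filter_uniq // => a.
    by rewrite mem_filter; case: (boolP (a \in g i)) => // /(sub_u i si) ->.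
  rewrite big_filter big_mkcond.
  over.
rewrite exchange_big; apply: eq_bigr => a _.
by rewrite -big_mkcond big_const_seq iter_addn_0 mulnC.
Qed.

(** * The commutation relation of the up and down operators *)

Section DifferentialPoset.
Context (r : nat) (d : Order.disp_t) (P : bPOrderType d).
Hypothesis hP : differential r P.
Implicit Types (x y z w : P) (m n : nat) (s : seq P) (f : P -> nat).

Definition lower_covers x := fset_set [set z : P | covered_by z x].
Definition upper_covers x := fset_set [set z : P | covered_by x z].

Lemma finite_lower_covers x : finite_set [set z : P | covered_by z x].
Proof.
apply: sub_finite_set (differential_locally_finite hP \bot%O x) => z /= /asboolP[zx _].
by rewrite Order.le0x Order.POrderTheory.ltW.
Qed.

(** (D3) turns a count of lower covers into a count of upper covers, so finiteness
    below x, which comes from the interval between the minimum and x, carries over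
    to the elements above x. *)
Lemma finite_upper_covers x : finite_set [set z : P | covered_by x z].
Proof.
have [k xk] := finite_lower_covers x.
by exists (k + r); apply: (differential_covers hP xk).
Qed.

Lemma mem_lower_covers x z : (z \in lower_covers x) = covered_by z x.
Proof.
by rewrite in_fset_set; [apply/idP/idP; rewrite inE | apply: finite_lower_covers].
Qed.

Lemma mem_upper_covers x z : (z \in upper_covers x) = covered_by x z.
Proof.
by rewrite in_fset_set; [apply/idP/idP; rewrite inE | apply: finite_upper_covers].
Qed.

(** Paths that go from x to z by an up step and a down step, against those that
    go down first: (D3) is the case z = x, (D2) the case z <> x. *)
Lemma count_two_step_paths x z :
  count (fun y => z \in lower_covers y) (upper_covers x)
    = count (fun w => z \in upper_covers w) (lower_covers x) + r * (z == x).
Proof.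
under eq_count do rewrite mem_lower_covers.
under [in RHS]eq_count do rewrite mem_upper_covers.
case: eqVneq => [->|/eqP zx].
  rewrite muln1.
  rewrite [LHS](_ : _ = #|` upper_covers x|); last first.
    by apply/eqP; rewrite -all_count; apply/allP => y; rewrite mem_upper_covers.
  rewrite [count _ _](_ : _ = #|` lower_covers x|); last first.
    by apply/eqP; rewrite -all_count; apply/allP => y; rewrite mem_lower_covers.
  have [k xk] := finite_lower_covers x.
  by rewrite (card_fset_set xk) (card_fset_set (differential_covers hP xk)).
rewrite muln0 addn0 -!size_filter.
rewrite -[LHS](@card_fset_set_enum _ [set y | covered_by z y /\ covered_by x y]); first last.
- move=> y; rewrite mem_filter mem_upper_covers /=.
  by split=> [[-> ->]//|/andP[]].
- by rewrite filter_uniq.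
rewrite -[RHS](@card_fset_set_enum _ [set y | covered_by y z /\ covered_by y x]); first last.
- move=> y; rewrite mem_filter mem_lower_covers /=.
  by split=> [[-> ->]//|/andP[]].
- by rewrite filter_uniq.
have [k ck] : finite_set [set y | covered_by y z /\ covered_by y x].
  by apply: sub_finite_set (finite_lower_covers x) => y [].
by rewrite (card_fset_set ck) (card_fset_set (differential_common_covers hP zx ck)).
Qed.

Lemma down_up_commutation f x :
  \sum_(y <- upper_covers x) \sum_(z <- lower_covers y) f z
    = \sum_(w <- lower_covers x) \sum_(z <- upper_covers w) f z + r * f x.
Proof.
(* A list containing x and every endpoint of a two-step path from x. *)
pose u := undup (x :: flatten [seq lower_covers y : seq P | y <- upper_covers x]
                   ++ flatten [seq upper_covers w : seq P | w <- lower_covers x]).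
have uniq_u : uniq u by rewrite undup_uniq.
rewrite !(@exchange_incidences _ _ _ _ u) //; first last.
- move=> y xy z yz; rewrite mem_undup inE mem_cat.
  by apply/orP; right; apply/orP; left; apply/flatten_mapP; exists y.
- move=> w xw z wz; rewrite mem_undup inE mem_cat.
  by apply/orP; right; apply/orP; right; apply/flatten_mapP; exists w.
have -> : r * f x = \sum_(z <- u) r * (z == x) * f z.
  rewrite (bigD1_seq x) //=; last by rewrite mem_undup mem_head.
  by rewrite eqxx muln1 big1 ?addn0 // => z /negPf ->; rewrite muln0.
rewrite -big_split; apply: eq_bigr => z _.
by rewrite count_two_step_paths mulnDl.
Qed.

(** * Saturated chains *)

Section Rank.
Context (rho : P -> nat).
Hypothesis hrho : rank_function rho.

(** The saturated chains from the minimum to x, built by removing the last element. The size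
    is a parameter because the recursion goes through the lower covers of x; the
    relevant value is the rank of x ([e_size_chains]). *)
Fixpoint chains_of_size m x : seq (seq P) :=
  if m is m'.+1 then
    [seq rcons s x | y <- lower_covers x, s <- chains_of_size m' y]
  else if x == \bot%O then [:: [::]] else [::].

Lemma mem_chains_of_size m x s :
  s \in chains_of_size m x
    = [&& size s == m, path covered_by \bot%O s & last \bot%O s == x].
Proof.
elim: m x s => [|m IHm] x s /=.
  case: s => [|y s]; last by case: ifP.
  by rewrite /= eq_sym; case: ifP.
apply/allpairsPdep/idP.
  move=> [y [s' [yx]]]; rewrite IHm => /and3P[/eqP <- ps /eqP sy] ->.
  by rewrite size_rcons rcons_path last_rcons !eqxx ps sy -mem_lower_covers yx.
case/lastP: s => [//|s y].
rewrite size_rcons eqSS rcons_path last_rcons => /and3P[sm /andP[ps sy] /eqP yx].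
exists (last \bot%O s), s; rewrite IHm mem_lower_covers sm ps eqxx -yx.
by split.
Qed.

Lemma uniq_chains_of_size m x : uniq (chains_of_size m x).
Proof.
elim: m x => [|m IHm] x /=; first by case: ifP.
apply: allpairs_uniq_dep => [|//|p q]; first exact: fset_uniq.
move=> /allpairsPdep[y [s [_ sy ->]]] /allpairsPdep[y' [s' [_ sy' ->]]] /=.
move=> /(@rcons_injl _ x) ss'; move: sy sy'; rewrite -{}ss'.
by rewrite !mem_chains_of_size => /and3P[_ _ /eqP <-] /and3P[_ _ /eqP <-].
Qed.

Lemma rank_path x s : path covered_by x s -> rho (last x s) = rho x + size s.
Proof.
elim: s x => [|y s IHs] x /=; first by rewrite addn0.
by move=> /andP[xy /IHs ->]; rewrite (hrho.2 _ _ xy) addSnnS.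
Qed.

Lemma e_size_chains x : e x = size (chains_of_size (rho x) x).
Proof.
apply: card_fset_set_enum => [|s]; first exact: uniq_chains_of_size.
rewrite mem_chains_of_size; split=> [/andP[ps /eqP sx]|/and3P[_ ps sx]].
  by rewrite ps sx eqxx -sx (rank_path _ _ ps) hrho.1 add0n eqxx.
by apply/andP.
Qed.

Lemma sum_lower_chains x : rho x != 0 -> \sum_(y <- lower_covers x) e y = e x.
Proof.
rewrite e_size_chains; case xn: (rho x) => [//|n] _ /=.
rewrite size_allpairs_dep sumnE big_map; apply: eq_big_seq => y.
by rewrite mem_lower_covers e_size_chains => /hrho.2; rewrite xn => -[->].
Qed.

(** The upper covers of x have positive rank, so e there is itself a sum over
    lower covers; commuting the two sums moves the problem to the lower covers of
    x, one rank below, at the cost of r * e x. The r * n of the induction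
    hypothesis and this r add up to r * n.+1. *)
Lemma sum_upper_chains x :
  \sum_(y <- upper_covers x) e y = r * (rho x).+1 * e x.
Proof.
have up_down x' : \sum_(y <- upper_covers x') e y
    = \sum_(w <- lower_covers x') \sum_(z <- upper_covers w) e z + r * e x'.
  rewrite -down_up_commutation; apply: eq_big_seq => y.
  by rewrite mem_upper_covers => /hrho.2 yn; rewrite sum_lower_chains // yn.
move xn: (rho x) => n; elim: n x xn => [|n IHn] x xn; rewrite up_down.
  rewrite big_seq big1 ?muln1 // => w.
  by rewrite mem_lower_covers => /hrho.2; rewrite xn.
rewrite (eq_big_seq (fun w => r * n.+1 * e w)) => [|w].
  by rewrite -big_distrr /= sum_lower_chains ?xn // -mulnDl -mulnSr.
by rewrite mem_lower_covers => /hrho.2; rewrite xn => -[nw]; rewrite IHn.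
Qed.

(** * Alternating walks *)

Fixpoint walks (up : bool) m x : seq (seq P) :=
  if m is m'.+1 then
    [seq y :: s | y <- if up then upper_covers x else lower_covers x,
                  s <- walks (~~ up) m' y]
  else [:: [::]].

Lemma mem_walks up m x s :
  (s \in walks up m x) = (size s == m) && alt_walk up x s.
Proof.
elim: m up x s => [|m IHm] up x s /=; first by case: s.
apply/allpairsPdep/idP => [[y [s' [xy]]]|].
  rewrite IHm => /andP[/eqP <- ws] -> /=.
  by rewrite eqxx ws andbT; case: up xy {IHm ws} => /=; rewrite ?mem_upper_covers ?mem_lower_covers.
case: s => //= y s; rewrite eqSS => /and3P[sm xy ws].
exists y, s; rewrite IHm sm ws; split=> //.
by case: up xy {ws} => /=; rewrite ?mem_upper_covers ?mem_lower_covers.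
Qed.

Lemma uniq_walks up m x : uniq (walks up m x).
Proof.
elim: m up x => [//|m IHm] up x /=.
apply: allpairs_uniq_dep => [|//|]; first by case: up; apply: fset_uniq.
by move=> [y s] [y' s'] _ _ /= [-> ->].
Qed.

Lemma t_count_walks m x y : t m x y = count (fun s => last x s == y) (walks true m x).
Proof.
rewrite -size_filter; apply: card_fset_set_enum => [|s].
  by rewrite filter_uniq ?uniq_walks.
by rewrite mem_filter mem_walks; split=> /and3P[? ? ?]; apply/and3P.
Qed.

(** Grouping the walks by their endpoint: t m x y vanishes outside the finite list
    of endpoints, so the sum over A reduces to a sum over that list. *)
Lemma sum_walk_ends (A : set P) m x f :
  (forall s, size s = m -> alt_walk true x s -> A (last x s)) ->
  \big[addn/0]_(y \in A) (t m x y * f y)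
    = \sum_(s <- walks true m x) f (last x s).
Proof.
move=> lastA; pose ends := undup [seq last x s | s <- walks true m x].
rewrite (@fsbigE _ _ _ _ _ ends); first last.
- move=> y _; rewrite mem_undup t_count_walks => yends.
  rewrite (_ : count _ _ = 0) //; apply/eqP; rewrite -leqn0 leqNgt -has_count.
  by apply: contra yends => /hasP[s sw /eqP <-]; apply: map_f.
- move=> y /=; rewrite mem_undup => /mapP[s + ->].
  by rewrite mem_walks => /andP[/eqP ? ?]; apply: lastA.
- exact: undup_uniq.
have endsA y : y \in ends -> y \in A.
  rewrite mem_undup inE => /mapP[s + ->].
  by rewrite mem_walks => /andP[/eqP ? ?]; apply: lastA.
rewrite big_seq_cond (eq_bigl (fun y => y \in ends)); last first.
  by move=> y; apply: andb_idr => /endsA.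
rewrite -big_seq.
(* Each walk reaches exactly one endpoint, so the one-element list [:: last x s]
   makes the right-hand side a double sum. *)
transitivity (\sum_(s <- walks true m x) \sum_(y <- [:: last x s]) f y); last first.
  by apply: eq_bigr => s _; rewrite big_seq1.
rewrite (@exchange_incidences _ _ _ _ ends) ?undup_uniq //; last first.
  by move=> s sw y; rewrite inE => /eqP ->; rewrite mem_undup map_f.
apply: eq_bigr => y _; rewrite t_count_walks; congr (_ * _).
by apply: eq_count => s; rewrite inE eq_sym.
Qed.

(** The walks that start upwards from rank n and those that start downwards from
    rank n.+1 are treated together, since the tail of one kind is of the other
    kind. The exponent is the number of up steps. *)
Lemma sum_walks_chains n up m x : rho x = n + ~~ up ->
  \sum_(s <- walks up m x) e (last x s) = (r * n.+1) ^ half (m + up) * e x.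
Proof.
elim: m up x => [|m IHm] up x; first by rewrite big_seq1; case: up; rewrite mul1n.
case: up => xn; rewrite /= big_allpairs_dep /=.
- rewrite (eq_big_seq (fun y => (r * n.+1) ^ half m * e y)) => [|y].
    rewrite -big_distrr /= sum_upper_chains xn addn0 mulnA -expnSr.
    by rewrite addn1.
  rewrite mem_upper_covers => /hrho.2 yn.
  by rewrite (IHm false) ?addn0 // yn xn addn0 addn1.
- rewrite (eq_big_seq (fun y => (r * n.+1) ^ half m.+1 * e y)) => [|y].
    by rewrite -big_distrr /= sum_lower_chains ?xn ?addn1 ?addn0.
  rewrite mem_lower_covers => /hrho.2; rewrite xn addn1 => -[yn].
  by rewrite (IHm true) ?addn0 // addn1.
Qed.

Lemma rank_alt_walk n up x s : rho x = n + ~~ up -> alt_walk up x s ->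
  rho (last x s) = n + odd (size s + ~~ up).
Proof.
elim: s up x => [|y s IHs] up x xn /=; first by rewrite xn; case: up {xn}.
move=> /andP[xy ws]; rewrite (IHs (~~ up)) //.
  by case: up xn {xy ws} => _; rewrite /= addn0 addn1 /= ?negbK.
case: up xn xy {ws} => /= xn /hrho.2; rewrite xn addn0 addn1.
  by move->.
by case.
Qed.

Lemma sum_up_down_walks n m x : rho x = n ->
  \big[addn/0]_(y \in rank_level rho (n + odd m)) (t m x y * e y)
    = (r * n.+1) ^ uphalf m * e x.
Proof.
move=> xn; rewrite sum_walk_ends; first by rewrite (sum_walks_chains n) ?addn1 ?addn0.
by move=> s sm /(rank_alt_walk n) /=; rewrite !addn0 sm => /(_ xn).
Qed.

End Rank.
End DifferentialPoset.

Theorem theorem6 (r : nat) (hr : 0 < r) (d : Order.disp_t) (P : bPOrderType d)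
    (hP : differential r P) (rho : P -> nat) (hrho : rank_function rho)
    (n : nat) (x : P) (hx : x \in rank_level rho n) :
  (forall k : nat,
     e x * r ^ k * (n + 1) ^ k =
     (\big[addn/0]_(y \in rank_level rho n) (t (k.*2) x y * e y))) /\
  (forall k : nat, 1 <= k ->
     e x * r ^ k * (n + 1) ^ k =
     (\big[addn/0]_(y \in rank_level rho (n + 1)) (t (k.*2).-1 x y * e y))).
Proof.
move: hx; rewrite inE => /= xn; split=> [k|[//|k] _].
  have := sum_up_down_walks r d P hP rho hrho n k.*2 x xn.
  rewrite odd_double addn0 uphalf_double => ->.
  by rewrite addn1 expnMn -mulnA mulnC.
have := sum_up_down_walks r d P hP rho hrho n k.*2.+1 x xn.
rewrite oddS odd_double /= doubleK => ->.
by rewrite addn1 -mulnA -expnMn mulnC.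
Qed.
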